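(* Consider a class of set selection problems under uncertainty. Suppose that, for any instance $(E,\mathcal{F},\{I_f\})$ of the class and any $e\in E$, one can decide whether $E\setminus\{e\}$ is an admissible query in time $T$ (this oracle may be applied to instances obtained by changing the interval of $e$), and that the corresponding minimum-weight set selection problem can be solved in time $T_{OPT}$. Let $K=\sum_{f\in E\setminus\{e\}}(|\ell_f|+|h_f|)$. Then for every $e\in E$ and every $\delta>0$ one can either decide that $T^-_e,T^+_e\in\{+\infty,-\infty\}$, or compute $a,b\in[-K,K]$ with $T^+_e\in[a,a+\delta]$ and $T^-_e\in[b,b+\delta]$, in time $\mathcal{O}(T\log(2K/\delta)+T_{OPT})$.
   Context: An instance consists of a finite ground set $E$, a nonempty collection $\mathcal{F}\subseteq 2^E$ of feasible sets, and intervals $I_f=[\ell_f,h_f]$ for $f\in E$; $w(S)=\sum_{f\in S}w_f$. For $e\in E$ and $w_{-e}\in\mathbb{R}^{E\setminus\{e\}}$, $\mathrm{OPT}^{-e}(w_{-e})=\min\{w(S)\mid S\in\mathcal{F},e\notin S\}$, $\mathrm{OPT}^{+e}(w_{-e})=\min\{w(S)\mid S\in\mathcal{F},e\in S\}$ with $w_e:=0$, and $T_e(w_{-e})=\mathrm{OPT}^{-e}-\mathrm{OPT}^{+e}$ ($+\infty$ if $e$ is in every feasible set, $-\infty$ if in none). $T^+_e$ and $T^-_e$ are the infimum and supremum of $T_e(w_{-e})$ over $w_{-e}\in\prod_{f\neq e}I_f$. A feasible set $S^*$ is universally optimal for a family of intervals if $w(S^* )\le w(S)$ for all $S\in\mathcal{F}$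 and all weight vectors lying in the intervals. A set $Q\subseteq E$ is an admissible query if for every choice of $w_f\in I_f$ ($f\in Q$), the instance with intervals $\{\{w_f\}\}_{f\in Q}\cup\{I_f\}_{f\in E\setminus Q}$ has a universally optimal solution. *)

(* Defs.v *)
From HB Require Import structures.
From mathcomp Require Import all_boot all_order all_algebra.
From mathcomp Require Import all_classical all_reals all_analysis.

Set Implicit Arguments.
Unset Strict Implicit.
Unset Printing Implicit Defensive.

Import Order.TTheory GRing.Theory Num.Theory.
Local Open Scope ring_scope.

Record instance (R : realType) : Type := Instance {
  ground : finType;
  feasible : {set {set ground}};
  lo : ground -> R;
  hi : ground -> R }.

Definition wf_instance (R : realType) (I : instance R) : Prop :=
  (exists S, S \in feasible I) /\ forall f : ground I, lo f <= hi f.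

Definition set_interval_of (R : realType) (I : instance R) (e : ground I)
    (x y : R) : instance R :=
  @Instance R (ground I) (feasible I)
    (fun f => if f == e then x else lo f)
    (fun f => if f == e then y else hi f).

Section SetSelection.
Variables (R : realType) (E : finType) (F : {set {set E}}).

Definition weight (w : E -> R) (S : {set E}) : R := \sum_(f in S) w f.

Definition min_weight_solution (w : E -> R) (S : {set E}) : Prop :=
  S \in F /\ forall S', S' \in F -> weight w S <= weight w S'.

Definition universally_optimal (l h : E -> R) (S : {set E}) : Prop :=
  S \in F /\ forall S', S' \in F ->
    forall w : E -> R, (forall f, l f <= w f <= h f) ->
    weight w S <= weight w S'.

Definition admissible_query (l h : E -> R) (Q : {set E}) : Prop :=
  forall v : E -> R, (forall f, f \in Q -> l f <= v f <= h f) ->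
  exists S, universally_optimal
    (fun f => if f \in Q then v f else l f)
    (fun f => if f \in Q then v f else h f) S.

(* A vector w_{-e} is represented by a total w : E -> R; OPT_without and
   OPT_with do not depend on the value of w at e. The minimum over the empty
   family is +oo. *)
Definition OPT_without (e : E) (w : E -> R) : \bar R :=
  \big[Order.min/+oo%E]_(S in F | e \notin S) (weight w S)%:E.

Definition OPT_with (e : E) (w : E -> R) : \bar R :=
  \big[Order.min/+oo%E]_(S in F | e \in S)
    (weight (fun f => if f == e then 0 else w f) S)%:E.

(* For nonempty F at most one of the two terms is infinite, so this is +oo
   when e is in every feasible set and -oo when it is in none. *)
Definition threshold (e : E) (w : E -> R) : \bar R :=
  (OPT_without e w - OPT_with e w)%E.

Definition box_off (l h : E -> R) (e : E) : set (E -> R) :=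
  [set w | forall f, f != e -> l f <= w f <= h f]%classic.

End SetSelection.

(* T^+_e is the infimum and T^-_e the supremum, despite the superscripts. *)
Definition Tplus (R : realType) (I : instance R) (e : ground I) : \bar R :=
  ereal_inf (threshold (feasible I) e @` box_off (@lo R I) (@hi R I) e)%classic.

Definition Tminus (R : realType) (I : instance R) (e : ground I) : \bar R :=
  ereal_sup (threshold (feasible I) e @` box_off (@lo R I) (@hi R I) e)%classic.

Definition Kbound (R : realType) (I : instance R) (e : ground I) : R :=
  \sum_(f : ground I | f != e) (`|lo f| + `|hi f|).

(* Two subroutines, each returning an answer together with the number of steps
   it takes. [adm_answer I e] is meant to decide whether E \ {e} is an
   admissible query for I; [opt_answer F w] to minimise w(S) over S in F. *)
Record oracles (R : realType) : Type := Oracles {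
  adm_answer : forall I : instance R, ground I -> bool;
  adm_steps : forall I : instance R, ground I -> nat;
  opt_answer : forall E : finType, {set {set E}} -> (E -> R) -> {set E};
  opt_steps : forall E : finType, {set {set E}} -> (E -> R) -> nat }.

(* The time of a call: its own steps plus the transfer of its argument, which
   is O(1) for a call that only replaces the interval of e, and one step per
   weight for the optimisation subroutine. *)
Definition adm_time (R : realType) (O : oracles R) (I : instance R)
  (e : ground I) : nat := (adm_steps O e).+1.

Definition opt_time (R : realType) (O : oracles R) (E : finType)
  (F : {set {set E}}) (w : E -> R) : nat := (#|E| + opt_steps O F w)%N.

Definition decides_admissible_within (R : realType) (O : oracles R)
    (I : instance R) (e : ground I) (T : nat) : Prop :=
  (adm_answer O e <-> admissible_query (feasible I) (@lo R I) (@hi R I) [set~ e])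
  /\ (adm_time O e <= T)%N.

Definition solves_min_weight_within (R : realType) (O : oracles R)
    (E : finType) (F : {set {set E}}) (w : E -> R) (T : nat) : Prop :=
  min_weight_solution F w (opt_answer O F w) /\ (opt_time O F w <= T)%N.

(* The machine model: a unit-cost real RAM with index registers, real
   registers, a real array holding the weights passed to the optimisation
   subroutine and a bit array receiving its solution. A program sees the
   interval endpoints through RLo and RHi, and the feasible sets only through
   the two subroutines. *)
Inductive arith := Add | Sub | Mul | Div.

Inductive instr :=
| NConst of nat & nat          (* n_i := k *)
| NSucc of nat & nat           (* n_i := n_j + 1 *)
| RConst of nat & int          (* r_i := z *)
| ROp of nat & arith & nat & nat  (* r_i := r_j op r_k *)
| RLo of nat & nat             (* r_i := lower endpoint of element n_j *)
| RHi of nat & nat             (* r_i := upper endpoint of element n_j *)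
| WStore of nat & nat          (* weight of element n_i := r_j *)
| CallAdm of nat & nat & nat   (* n_i := admissibility for I_e := [r_j, r_k] *)
| CallOpt                      (* bits := optimal set for the stored weights *)
| NBit of nat & nat.           (* n_i := membership bit of element n_j *)

Inductive test := NLt of nat & nat | RLt of nat & nat.

Inductive prog :=
| Do of instr
| Seq of prog & prog
| If of test & prog & prog
| While of test & prog.

Record state (R : realType) : Type := State {
  nreg : nat -> nat;
  rreg : nat -> R;
  weights : nat -> R;
  bits : nat -> bool }.

Section Semantics.
Variables (R : realType) (O : oracles R) (I : instance R) (e : ground I).

Definition upd (T : Type) (m : nat -> T) (i : nat) (x : T) : nat -> T :=
  fun j => if j == i then x else m j.

Definition set_nreg (s : state R) (i k : nat) : state R :=
  State (upd (nreg s) i k) (rreg s) (weights s) (bits s).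

Definition set_rreg (s : state R) (i : nat) (x : R) : state R :=
  State (nreg s) (upd (rreg s) i x) (weights s) (bits s).

Definition eval_arith (o : arith) (x y : R) : R :=
  match o with
  | Add => x + y
  | Sub => x - y
  | Mul => x * y
  | Div => x / y
  end.

(* Elements are numbered from 0 to #|ground I| - 1 by enum_rank. *)
Definition stored_weights (s : state R) : ground I -> R :=
  fun f => weights s (enum_rank f).

Definition step (c : instr) (s : state R) : state R :=
  match c with
  | NConst i k => set_nreg s i k
  | NSucc i j => set_nreg s i (nreg s j).+1
  | RConst i z => set_rreg s i z%:~R
  | ROp i o j k => set_rreg s i (eval_arith o (rreg s j) (rreg s k))
  | RLo i j => set_rreg s i (nth 0 [seq lo f | f <- enum (ground I)] (nreg s j))
  | RHi i j => set_rreg s i (nth 0 [seq hi f | f <- enum (ground I)] (nreg s j))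
  | WStore i j =>
      State (nreg s) (rreg s) (upd (weights s) (nreg s i) (rreg s j)) (bits s)
  | CallAdm i j k => set_nreg s i
      (adm_answer O (e : ground (set_interval_of e (rreg s j) (rreg s k))))
  | CallOpt => State (nreg s) (rreg s) (weights s)
      (fun k => nth false
        [seq f \in opt_answer O (feasible I) (stored_weights s)
           | f <- enum (ground I)] k)
  | NBit i j => set_nreg s i (bits s (nreg s j))
  end.

Definition cost (c : instr) (s : state R) : nat :=
  match c with
  | CallAdm _ j k =>
      adm_time O (e : ground (set_interval_of e (rreg s j) (rreg s k)))
  | CallOpt => opt_time O (feasible I) (stored_weights s)
  | _ => 1
  end.

Definition eval_test (b : test) (s : state R) : bool :=
  match b with
  | NLt i j => (nreg s i < nreg s j)%N
  | RLt i j => rreg s i < rreg s j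
  end.

(* exec p s s' t: started in s, p halts in s' after time t. *)
Inductive exec : prog -> state R -> state R -> nat -> Prop :=
| ExecDo c s : exec (Do c) s (step c s) (cost c s)
| ExecSeq p q s s1 s2 t1 t2 :
    exec p s s1 t1 -> exec q s1 s2 t2 -> exec (Seq p q) s s2 (t1 + t2)
| ExecIf b p q s s' t :
    exec (if eval_test b s then p else q) s s' t -> exec (If b p q) s s' t.+1
| ExecWhileStop b p s : ~~ eval_test b s -> exec (While b p) s s 1
| ExecWhileLoop b p s s1 s2 t1 t2 :
    eval_test b s -> exec p s s1 t1 -> exec (While b p) s1 s2 t2 ->
    exec (While b p) s s2 (t1 + t2).+1.

(* Input: n_0 = |E|, n_1 = the index of e, r_0 = delta. *)
Definition init_state (delta : R) : state R :=
  State (upd (upd (fun=> 0%N) 0 #|ground I|) 1 (enum_rank e))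
        (upd (fun=> 0) 0 delta) (fun=> 0) (fun=> false).

End Semantics.

(* Output: n_0 = 0 announces finite values, located by a = r_0 and b = r_1;
   n_0 <> 0 announces that both T^+_e and T^-_e are infinite. *)
Definition says_infinite (R : realType) (s : state R) : bool := nreg s 0 != 0%N.
Definition output_a (R : realType) (s : state R) : R := rreg s 0.
Definition output_b (R : realType) (s : state R) : R := rreg s 1.

(* The factor log(2K/delta) of an O-bound, with the usual provisos: the base-2
   logarithm for x >= 2, one (not an arbitrarily small fraction) for
   1 < x < 2, and zero where the logarithm is nonpositive or undefined. *)
Definition log_factor (R : realType) (x : R) : R :=
  if x <= 1 then 0 else Num.max 1 (ln x / ln 2).

(* Main.v *)
(* For fixed w_{-e} a universally optimal set exists for w_e in [x, y] exactly
   when T_e(w_{-e}) is not strictly between x and y, so E \ {e} is an admissible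
   query for I_e = [x, y] iff no threshold falls strictly inside (x, y). Since
   |T_e| <= K whenever T_e is finite, the query with I_e = [-K-1, y] decides
   y <= T^+_e and the one with I_e = [x, K+1] decides T^-_e <= x, with no appeal
   to the continuity of T_e; two bisections of [-K, K] finish. Infinite
   thresholds are detected by two minimisations with weights +1 and -1 on e and 0
   elsewhere. *)

Require Import Defs.
From HB Require Import structures.
From mathcomp Require Import all_boot all_order all_algebra.
From mathcomp Require Import all_classical all_reals all_analysis.
From mathcomp Require Import lra zify.

Set Implicit Arguments.
Unset Strict Implicit.
Unset Printing Implicit Defensive.

Import Order.TTheory GRing.Theory Num.Theory.
Local Open Scope ring_scope.

(** * Minima of real families with default value +oo *)

(** Seeding the minimum with a member [f j] of the family leaves its value unchanged and replaces
    the default [+oo] by a real number. *)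
Lemma bigmin_EFin (R : realType) (J : finType) (P : pred J) (f : J -> R)
    (j : J) : P j ->
  \big[Order.min/+oo%E]_(i | P i) (f i)%:E =
  (\big[Order.min/f j]_(i | P i) f i)%:E.
Proof.
move=> Pj; apply/le_anti/andP; split.
  have /bigmin_leP : \big[Order.min/f j]_(i | P i) f i <=
                     \big[Order.min/f j]_(i | P i) f i by [].
  case=> [le_fj|[i Pi le_fi]].
    by apply: (bigmin_inf j) => //; rewrite lee_fin.
  by apply: (bigmin_inf i) => //; rewrite lee_fin.
apply/bigmin_geP; split=> [|i Pi]; first exact: leey.
by rewrite lee_fin; apply: bigmin_le_cond.
Qed.

Lemma bigmin_attained (R : realType) (J : finType) (P : pred J) (f : J -> R)
    (j : J) : P j ->
  exists2 i, P i & \big[Order.min/f j]_(i | P i) f i = f i.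
Proof.
move=> Pj.
have /bigmin_leP : \big[Order.min/f j]_(i | P i) f i <=
                   \big[Order.min/f j]_(i | P i) f i by [].
case=> [le_fj|[i Pi le_fi]]; [exists j => // | exists i => //].
  by apply/le_anti; rewrite le_fj bigmin_le_cond.
by apply/le_anti; rewrite le_fi bigmin_le_cond.
Qed.

(** * The threshold of a single weight vector, and admissibility *)

Section Threshold.
Variables (R : realType) (E : finType) (F : {set {set E}}) (e : E).

(** The weights used in [OPT_with]. Using them for both minima removes the value at [e], leaving
    only the part of [w] that matters. *)
Definition off (w : E -> R) : E -> R := fun f => if f == e then 0 else w f.

Lemma weight_off (w : E -> R) (S : {set E}) :
  weight w S = weight (off w) S + (if e \in S then w e else 0).
Proof.
have E1 f : w f = off w f + (if f == e then w e else 0).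
  by rewrite /off; case: eqP => [->|_]; rewrite ?add0r ?addr0.
rewrite {1}/weight (eq_bigr _ (fun f _ => E1 f)) big_split /=; congr (_ + _).
case: ifP => eS; last first.
  by rewrite big1 // => f fS; case: eqP => // fe; rewrite -fe fS in eS.
rewrite (bigD1 e) //= eqxx big1 ?addr0 // => f /andP[_ /negbTE ->//].
Qed.

(** With indicators over a common index set, the weights of two different sets can be subtracted
    term by term. *)
Lemma weight_offE (w : E -> R) (S : {set E}) :
  weight (off w) S = \sum_(f | f != e) (f \in S)%:R * w f.
Proof.
rewrite /weight [RHS]big_mkcond [LHS]big_mkcond /=; apply: eq_bigr => f _.
by rewrite /off; case: eqP; case: (f \in S); rewrite /= ?mul1r ?mul0r.
Qed.

Variables Sm Sp : {set E}.
Hypotheses (SmF : Sm \in F) (eSm : e \notin Sm).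
Hypotheses (SpF : Sp \in F) (eSp : e \in Sp).

Definition opt_without (w : E -> R) : R :=
  \big[Order.min/weight (off w) Sm]_(S in F | e \notin S) weight (off w) S.

Definition opt_with (w : E -> R) : R :=
  \big[Order.min/weight (off w) Sp]_(S in F | e \in S) weight (off w) S.

Definition thr (w : E -> R) : R := opt_without w - opt_with w.

Lemma thresholdE (w : E -> R) : threshold F e w = (thr w)%:E.
Proof.
rewrite /threshold /thr EFinB; congr (_ - _)%E; last first.
  by rewrite -bigmin_EFin // SpF.
rewrite -bigmin_EFin ?SmF //; apply: eq_bigr => S /andP[_ /negbTE eS].
by rewrite weight_off eS addr0.
Qed.

Lemma opt_withoutP (w : E -> R) : exists S,
  [/\ S \in F, e \notin S & opt_without w = weight (off w) S].
Proof.
have [|S /andP[SF eS] EqS] := @bigmin_attained R _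
  [pred S : {set E} | (S \in F) && (e \notin S)] (weight (off w)) Sm.
  by rewrite /= SmF.
by exists S.
Qed.

Lemma opt_withP (w : E -> R) : exists S,
  [/\ S \in F, e \in S & opt_with w = weight (off w) S].
Proof.
have [|S /andP[SF eS] EqS] := @bigmin_attained R _
  [pred S : {set E} | (S \in F) && (e \in S)] (weight (off w)) Sp.
  by rewrite /= SpF.
by exists S.
Qed.

Lemma opt_without_le (w : E -> R) (S : {set E}) :
  S \in F -> e \notin S -> opt_without w <= weight (off w) S.
Proof. by move=> SF eS; apply: bigmin_le_cond; rewrite SF. Qed.

Lemma opt_with_le (w : E -> R) (S : {set E}) :
  S \in F -> e \in S -> opt_with w <= weight (off w) S.
Proof. by move=> SF eS; apply: bigmin_le_cond; rewrite SF. Qed.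

(** Both minima are attained, and the indicators of the two minimisers differ by at most 1 in
    absolute value, so each [f] contributes at most [|w f|]. *)
Lemma thr_bound (l h w : E -> R) : box_off l h e w ->
  `|thr w| <= \sum_(f | f != e) (`|l f| + `|h f|).
Proof.
move=> bw; have [S [_ _]] := opt_withoutP w; have [S' [_ _]] := opt_withP w.
rewrite /thr => -> ->; rewrite !weight_offE -sumrB.
apply: le_trans (ler_norm_sum _ _ _) _; apply: ler_sum => f fe.
have /andP[lw wh] := bw f fe.
have: `|w f| <= `|l f| + `|h f|.
  rewrite ler_norml; have := ler_norm (- l f); have := ler_norm (h f).
  rewrite normrN; have := normr_ge0 (l f); have := normr_ge0 (h f); lra.
apply: le_trans; rewrite -mulrBl normrM ler_piMl //.
by case: (_ \in _); case: (_ \in _);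
  rewrite ?subrr ?subr0 ?sub0r ?normrN ?normr1 ?normr0.
Qed.

(** Fix the weights off [e]. Sets avoiding [e] cost at least [opt_without], those containing [e] at
    least [opt_with] plus the weight of [e]. An optimum containing [e] must survive the dearest
    value [y], which forces [y <= thr]; one avoiding [e] must survive the cheapest value [x], which
    forces [thr <= x]. Conversely, the minimiser of the corresponding side is universally
    optimal. *)
Lemma admissible_queryP (l h : E -> R) (x y : R) : x <= y ->
  admissible_query F (fun f => if f == e then x else l f)
    (fun f => if f == e then y else h f) [set~ e] <->
  forall w, box_off l h e w -> thr w <= x \/ y <= thr w.
Proof.
move=> xy; split=> [adm w bw | gap v bv].
  have [f|S [SF Smin]] := adm w.
    by rewrite !inE => fe; rewrite (negbTE fe); exact: bw.
  have SminE z : x <= z <= y -> forall S', S' \in F ->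
      weight (off w) S + (if e \in S then z else 0) <=
      weight (off w) S' + (if e \in S' then z else 0).
    move=> xzy S' S'F; pose w' f := if f == e then z else w f.
    have -> : off w = off w' by apply/funext => f; rewrite /off /w'; case: eqP.
    have w'e : w' e = z by rewrite /w' eqxx.
    rewrite -w'e -!weight_off; apply: Smin => // f; rewrite !inE /w'.
    by case: eqP => //= _; rewrite lexx.
  have [S1 [S1F eS1 opt1]] := opt_withoutP w.
  have [S2 [S2F eS2 opt2]] := opt_withP w.
  rewrite /thr; have [eS|eS] := boolP (e \in S).
    right; have := SminE y _ S1 S1F; rewrite eS (negbTE eS1) -opt1.
    have := opt_with_le w SF eS; rewrite xy lexx => le1 /(_ isT); lra.
  left; have := SminE x _ S2 S2F; rewrite (negbTE eS) eS2 -opt2.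
  have := opt_without_le w SF eS; rewrite xy lexx => le1 /(_ isT); lra.
have bw : box_off l h e v.
  by move=> f fe; have := bv f; rewrite !inE fe (negbTE fe) => /(_ isT).
(* Off [e] every queried interval is the point [v f], so [w] can differ from [v] only at [e]. *)
have weightE w S : (forall f, (if f \in [set~ e] then v f else
      if f == e then x else l f) <= w f <= (if f \in [set~ e] then v f else
      if f == e then y else h f)) ->
    weight w S = weight (off v) S + (if e \in S then w e else 0) /\ x <= w e <= y.
  move=> bw'; split; last by have := bw' e; rewrite !inE eqxx.
  rewrite weight_off; congr (weight _ _ + _); apply/funext => f; rewrite /off.
  case: eqP => // /eqP fe; have := bw' f; rewrite !inE fe /=.
  by move=> ?; apply/le_anti; rewrite andbC.
have [S1 [S1F eS1 opt1]] := opt_withoutP v.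
have [S2 [S2F eS2 opt2]] := opt_withP v.
have := gap v bw; rewrite /thr => -[le_x|le_y].
  exists S1; split=> // S' S'F w bw'.
  have [-> /andP[xw wy]] := weightE w S1 bw'; have [-> _] := weightE w S' bw'.
  rewrite (negbTE eS1) -opt1; case: ifPn => eS'.
    by have := opt_with_le v S'F eS'; lra.
  by have := opt_without_le v S'F eS'; lra.
exists S2; split=> // S' S'F w bw'.
have [-> /andP[xw wy]] := weightE w S2 bw'; have [-> _] := weightE w S' bw'.
rewrite eS2 -opt2; case: ifPn => eS'.
  by have := opt_with_le v S'F eS'; lra.
by have := opt_without_le v S'F eS'; lra.
Qed.

End Threshold.

(** * The extreme thresholds: oracle tests, bounds and infinite cases *)

Section Extremes.
Variables (R : realType) (I : instance R) (e : ground I).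

(** For a nonempty feasible family this is exactly the case of real thresholds. *)
Definition finite_threshold : Prop :=
  (exists2 S, S \in feasible I & e \notin S) /\
  (exists2 S, S \in feasible I & e \in S).

(** No threshold lies below [- Kbound e], so the alternative [thr w <= x] is void and admissibility
    says that [y] is a lower bound of all thresholds. The infimum need not be attained for this. *)
Lemma Tplus_ge_admissible (x y : R) : finite_threshold ->
  x < - Kbound e -> x <= y ->
  admissible_query (feasible I) (@lo R (set_interval_of e x y))
    (@hi R (set_interval_of e x y)) [set~ e] <-> (y%:E <= Tplus e)%E.
Proof.
move=> [[Sm SmF eSm] [Sp SpF eSp]] xK xy.
rewrite (admissible_queryP SmF eSm SpF eSp _ _ xy); split.
  move=> gap; apply: le_ereal_inf_tmp => _ [w bw <-].
  rewrite (thresholdE SmF eSm SpF eSp) lee_fin.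
  have := thr_bound SmF eSm SpF eSp bw; have [le_x|//] := gap w bw.
  by rewrite ler_norml => /andP[]; rewrite /Kbound in xK; lra.
move=> le_T w bw; right; rewrite -lee_fin -(thresholdE SmF eSm SpF eSp).
by apply: le_trans le_T _; apply: ereal_inf_lbound; exists w.
Qed.

Lemma Tminus_le_admissible (x y : R) : finite_threshold ->
  Kbound e < y -> x <= y ->
  admissible_query (feasible I) (@lo R (set_interval_of e x y))
    (@hi R (set_interval_of e x y)) [set~ e] <-> (Tminus e <= x%:E)%E.
Proof.
move=> [[Sm SmF eSm] [Sp SpF eSp]] Ky xy.
rewrite (admissible_queryP SmF eSm SpF eSp _ _ xy); split.
  move=> gap; apply: ge_ereal_sup => _ [w bw <-].
  rewrite (thresholdE SmF eSm SpF eSp) lee_fin.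
  have := thr_bound SmF eSm SpF eSp bw; have [//|le_y] := gap w bw.
  by rewrite ler_norml => /andP[]; rewrite /Kbound in Ky; lra.
move=> le_T w bw; left; rewrite -lee_fin -(thresholdE SmF eSm SpF eSp).
by apply: le_trans le_T; apply: ereal_sup_ubound; exists w.
Qed.

Hypothesis wfI : wf_instance I.

Let box_lo : box_off (@lo R I) (@hi R I) e (@lo R I).
Proof. by move=> f _; rewrite lexx wfI.2. Qed.

Lemma Tplus_Tminus_bound : finite_threshold ->
  ((- Kbound e)%:E <= Tplus e <= (Kbound e)%:E)%E /\
  ((- Kbound e)%:E <= Tminus e <= (Kbound e)%:E)%E.
Proof.
move=> [[Sm SmF eSm] [Sp SpF eSp]].
have thrK w : box_off (@lo R I) (@hi R I) e w ->
    ((- Kbound e)%:E <= threshold (feasible I) e w <= (Kbound e)%:E)%E.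
  move=> bw; rewrite (thresholdE SmF eSm SpF eSp) !lee_fin -ler_norml.
  exact: thr_bound bw.
have /andP[geK leK] := thrK _ box_lo.
split; apply/andP; split.
- by apply: le_ereal_inf_tmp => _ [w bw <-]; have /andP[] := thrK w bw.
- by apply: le_trans leK; apply: ereal_inf_lbound; exists (@lo R I).
- by apply: le_trans geK _; apply: ereal_sup_ubound; exists (@lo R I).
- by apply: ge_ereal_sup => _ [w bw <-]; have /andP[] := thrK w bw.
Qed.

(** The box contains [lo], so the set of thresholds is a genuine singleton; over an empty box the
    infimum would be +oo and the supremum -oo. *)
Lemma constant_threshold (c : \bar R) :
  (forall w, threshold (feasible I) e w = c) -> Tplus e = c /\ Tminus e = c.
Proof.
move=> thrc; rewrite /Tplus /Tminus.
have -> : (threshold (feasible I) e @` box_off (@lo R I) (@hi R I) e = [set c])%classic.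
  apply/seteqP; split=> [_ [w _ <-] //=|_ ->]; by exists (@lo R I).
by rewrite ereal_inf1 ereal_sup1.
Qed.

(** The minimum over the sets avoiding [e] is empty, hence +oo, while any feasible set makes the
    other minimum real, so the difference is +oo. *)
Lemma infinite_of_mandatory : (forall S, S \in feasible I -> e \in S) ->
  Tplus e = +oo%E /\ Tminus e = +oo%E.
Proof.
move=> eF; apply: constant_threshold => w; have [[S0 S0F] _] := wfI.
rewrite /threshold /OPT_without big_pred0 => [|S]; last first.
  by apply/negP => /andP[/eF ->].
by rewrite /OPT_with (@bigmin_EFin _ _ _ _ S0) ?S0F ?eF.
Qed.

Lemma infinite_of_forbidden : (forall S, S \in feasible I -> e \notin S) ->
  Tplus e = -oo%E /\ Tminus e = -oo%E.
Proof.
move=> eF; apply: constant_threshold => w; have [[S0 S0F] _] := wfI.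
rewrite /threshold /OPT_with [X in (_ - X)%E]big_pred0 => [|S]; last first.
  by apply/negP => /andP[/eF/negP].
by rewrite /OPT_without (@bigmin_EFin _ _ _ _ S0) ?S0F ?eF.
Qed.

End Extremes.

(** * Execution of loop-free programs and bounded loops *)

Fixpoint loop_free (p : prog) : bool :=
  match p with
  | Do _ => true
  | Seq p q => loop_free p && loop_free q
  | If _ p q => loop_free p && loop_free q
  | While _ _ => false
  end.

Section Run.
Variables (R : realType) (O : oracles R) (I : instance R) (e : ground I).

(* Only meaningful on loop-free programs: loops are skipped. *)
Fixpoint run (p : prog) (s : state R) : state R :=
  match p with
  | Do c => step O e c s
  | Seq p q => run q (run p s)
  | If b p q => if eval_test b s then run p s else run q s
  | While _ _ => s
  end.

Fixpoint run_time (p : prog) (s : state R) : nat :=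
  match p with
  | Do c => cost O e c s
  | Seq p q => run_time p s + run_time q (run p s)
  | If b p q => (if eval_test b s then run_time p s else run_time q s).+1
  | While _ _ => 0
  end.

Lemma exec_run (p : prog) (s : state R) :
  loop_free p -> exec O e p s (run p s) (run_time p s).
Proof.
elim: p s => [c|p IHp q IHq|b p IHp q IHq|//] s /=.
- by move=> _; exact: ExecDo.
- by move=> /andP[/IHp Ep /IHq Eq]; exact: ExecSeq (Ep s) (Eq _).
- move=> /andP[/IHp Ep /IHq Eq]; apply: ExecIf.
  by case: (eval_test b s); [exact: Ep | exact: Eq].
Qed.

(** The index of [inv] is a budget of further rounds; the loop may stop before it is spent, so the
    final index is existential. Each round costs the body plus one test, and the failing test adds
    1. *)
Lemma exec_while (b : test) (p : prog) (c : nat) (inv : nat -> state R -> Prop) :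
  loop_free p ->
  (forall s, inv 0 s -> ~~ eval_test b s) ->
  (forall k s, inv k.+1 s -> eval_test b s ->
     inv k (run p s) /\ (run_time p s <= c)%N) ->
  forall k s, inv k s -> exists s' t,
    [/\ exec O e (While b p) s s' t, exists j, inv j s',
        ~~ eval_test b s' & (t <= k * c.+1 + 1)%N].
Proof.
move=> lfp inv0 invS; elim=> [|k IHk] s invs.
  exists s, 1%N; split=> //; last exact: inv0.
    by apply: ExecWhileStop; exact: inv0.
  by exists 0%N.
have [bs|nbs] := boolP (eval_test b s); last first.
  exists s, 1%N; split=> //; [exact: ExecWhileStop | by exists k.+1].
have [invk tc] := invS _ _ invs bs.
have [s' [t [ex invj nb tk]]] := IHk _ invk.
exists s', (run_time p s + t).+1; split=> //; last by lia.
by apply: ExecWhileLoop bs _ ex; exact: exec_run.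
Qed.

End Run.

(** * Number of bisection rounds and the time budget *)

Lemma halvings (R : realType) (x y : R) : 0 < y -> exists k : nat,
  x <= y * 2 ^+ k /\ k%:R <= 2 * log_factor (x / y).
Proof.
move=> y0; rewrite /log_factor.
have [xy|xy] := leP (x / y) 1.
  by exists 0%N; rewrite expr0 mulr0 lexx mulr1; split=> //; rewrite -(mul1r y) -ler_pdivrMr.
have ln2 : 0 < ln 2 :> R by apply: ln_gt0; lra.
have lnz : 0 <= ln (x / y) / ln 2 by rewrite divr_ge0 ?ltW // ln_gt0.
set l := ln (x / y) / ln 2 in lnz *.
(* Rounding up costs one extra round: [k <= l + 1 <= 2 * max 1 l], where the lower bound 1 in
   [log_factor] absorbs the extra round. *)
exists (Num.trunc l).+1; split.
  have := ltW (truncnS_gt l); set k := (_).+1.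
  rewrite /l ler_pdivrMr // mulr_natl -lnXn ?ltr0n // ler_ln ?posrE ?exprn_gt0 //; last first.
    by apply: lt_trans xy.
  by rewrite ler_pdivrMr // mulrC.
have /andP[le_l _] := truncn_itv lnz.
have l1 : 1 <= Num.max 1 l by rewrite le_max lexx.
have ll : l <= Num.max 1 l by rewrite le_max lexx orbT.
rewrite -natr1; lra.
Qed.

(** Here [n] is the size of the ground set, [k] the number of halvings, [d] the time of detection
    and [t] that of [locate]; the two extra steps are the branchings of [threshold_prog]. Since
    [1 <= T], a round of length [T + 5] costs at most [6 * T]. *)
Lemma time_budget (n T TOPT k d t : nat) :
  (n <= TOPT)%N -> (1 <= TOPT)%N -> (1 <= T)%N -> (d <= 2 * TOPT + 6)%N ->
  (t <= n * 10 + k * (T + 5) * 2 + 14)%N ->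
  (d + t.+2 <= 100 * TOPT + 12 * (T * k))%N.
Proof.
move=> nT T0 T1 dT tT; have Tk : (k <= T * k)%N by rewrite leq_pmull.
by move: tT; rewrite mulnDr (mulnC k T); lia.
Qed.

(** * The program *)

(* Registers: n_2 counter, n_3 and n_4 the bits of e in the two detection
   solutions, n_5 = 0, n_7 oracle answer; r_0 = delta, r_3 = K, r_7 width of the
   current bracket, r_6 and r_1 its lower end in the search for T^+_e and T^-_e,
   r_8 the fixed end of the queried interval, r_9 = 2, r_10 = 0. *)
Definition add_abs (load : instr) : prog :=
  Seq (Do load)
      (If (RLt 4 10) (Do (ROp 3 Defs.Sub 3 4)) (Do (ROp 3 Add 3 4))).

(* A no-op: n_6 is never read. *)
Definition skip : prog := Do (NConst 6 0).

(** Indices can only be compared strictly, so the index of [e] is recognised by the failure of both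
    tests. *)
Definition sum_body : prog :=
  let add := Seq (add_abs (RLo 4 2)) (add_abs (RHi 4 2)) in
  Seq (If (NLt 2 1) add (If (NLt 1 2) add skip)) (Do (NSucc 2 2)).

(** The offset 1 puts the fixed end [- K - 1] strictly outside the range of the thresholds. *)
Definition plus_init : prog :=
  Seq (Do (ROp 6 Defs.Sub 10 3)) (Seq (Do (ROp 7 Add 3 3)) (Seq (Do (RConst 8 1))
  (Seq (Do (ROp 8 Defs.Sub 6 8)) (Do (RConst 9 2))))).

(** The width is halved whatever the answer; only the lower end depends on it. Adding r_10 = 0
    serves as a register move. *)
Definition plus_body : prog :=
  Seq (Do (ROp 7 Div 7 9)) (Seq (Do (ROp 2 Add 6 7)) (Seq (Do (CallAdm 7 8 2))
  (If (NLt 5 7) (Do (ROp 6 Add 2 10)) skip))).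

Definition minus_init : prog :=
  Seq (Do (ROp 1 Defs.Sub 10 3)) (Seq (Do (ROp 7 Add 3 3)) (Seq (Do (RConst 8 1))
  (Do (ROp 8 Add 3 8)))).

(** The branches are swapped with respect to [plus_body]: a positive answer now bounds the supremum
    from above by the midpoint. *)
Definition minus_body : prog :=
  Seq (Do (ROp 7 Div 7 9)) (Seq (Do (ROp 2 Add 1 7)) (Seq (Do (CallAdm 7 2 8))
  (If (NLt 5 7) skip (Do (ROp 1 Add 2 10))))).

Definition output_prog : prog :=
  Seq (Do (ROp 0 Add 6 10)) (Do (NConst 0 0)).

Definition locate : prog :=
  Seq (While (NLt 2 0) sum_body)
  (Seq plus_init (Seq (While (RLt 0 7) plus_body)
  (Seq minus_init (Seq (While (RLt 0 7) minus_body) output_prog)))).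

Definition probe (z : int) (i : nat) : prog :=
  Seq (Do (RConst 2 z)) (Seq (Do (WStore 1 2)) (Seq (Do CallOpt) (Do (NBit i 1)))).

Definition detect : prog := Seq (probe 1 3) (probe (-1) 4).

Definition threshold_prog : prog :=
  Seq detect (If (NLt 5 3) (Do (NConst 0 1))
                 (If (NLt 5 4) locate (Do (NConst 0 1)))).

(** * Correctness and time of the summation and the two bisections *)

Section Correctness.
Variables (R : realType) (O : oracles R) (I : instance R) (e : ground I).
Variable (delta : R).

(** Indexed by numbers, exactly as [RLo] and [RHi] read the endpoints, so that partial sums can
    follow the loop counter. *)
Definition summand (j : nat) : R :=
  `|nth 0 [seq lo f | f <- enum (ground I)] j| +
  `|nth 0 [seq hi f | f <- enum (ground I)] j|.

Lemma nth_map_enum_rank (A : Type) (x0 : A) (g : ground I -> A) (f : ground I) :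
  nth x0 [seq g f | f <- enum (ground I)] (enum_rank f) = g f.
Proof. by rewrite (nth_map f) -?cardE ?ltn_ord // nth_enum_rank. Qed.

Lemma sum_summand :
  \sum_(0 <= j < #|ground I| | j != enum_rank e) summand j = Kbound e.
Proof.
rewrite big_mkord /Kbound (reindex (@enum_rank (ground I))); last first.
  by exists enum_val => i _; rewrite ?enum_rankK ?enum_valK.
apply: eq_big => f; first by rewrite (inj_eq val_inj) (inj_eq enum_rank_inj).
by rewrite /summand !nth_map_enum_rank.
Qed.

Definition inputs_kept (s : state R) : Prop :=
  [/\ nreg s 5 = 0%N, rreg s 0 = delta & rreg s 10 = 0].

Lemma run_add_abs (load : instr) (x : R) (s : state R) :
  step O e load s = set_rreg s 4 x -> cost O e load s = 1%N -> rreg s 10 = 0 ->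
  run O e (add_abs load) s = set_rreg (set_rreg s 4 x) 3 (rreg s 3 + `|x|) /\
  run_time O e (add_abs load) s = 3.
Proof.
move=> Estep Ecost r10; rewrite /= Estep Ecost /= /upd /= r10.
by case: ltrP => x0; rewrite ?(ger0_norm x0) ?(ltr0_norm x0).
Qed.

Definition sum_inv (k : nat) (s : state R) : Prop :=
  [/\ inputs_kept s, nreg s 0 = #|ground I|, nreg s 1 = enum_rank e,
      (nreg s 2 + k)%N = #|ground I| &
      rreg s 3 = \sum_(0 <= j < nreg s 2 | j != enum_rank e) summand j].

Lemma sum_loop (s : state R) : sum_inv #|ground I| s -> exists s' t,
  [/\ exec O e (While (NLt 2 0) sum_body) s s' t, inputs_kept s',
      rreg s' 3 = Kbound e & (t <= #|ground I| * 10 + 1)%N].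
Proof.
move=> invs.
(* A body costs at most 9: two tests, two calls of [add_abs] at 3 steps each, and the increment. *)
have [|k s0|s' [t [ex [j [kept n0 n1 n2 r3]] stop tc]]] :=
  @exec_while R O I e (NLt 2 0) sum_body 9 sum_inv isT _ _ _ _ invs.
- by move=> s0 [_ n0 _ n2 _]; rewrite /= n0 -n2 addn0 ltnn.
- move=> [[n5 r0 r10] n0 n1 n2 r3] _.
  have [E1 t1] := @run_add_abs (RLo 4 2)
    (nth 0 [seq lo f | f <- enum (ground I)] (nreg s0 2)) s0 erefl erefl r10.
  have [] := @run_add_abs (RHi 4 2)
    (nth 0 [seq hi f | f <- enum (ground I)] (nreg s0 2))
    (run O e (add_abs (RLo 4 2)) s0).
  + by rewrite E1.
  + by rewrite E1.
  + by rewrite E1.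
  rewrite E1; set s1 := set_rreg _ _ _ => E2 t2.
  have sumS : \sum_(0 <= j < (nreg s0 2).+1 | j != enum_rank e) summand j =
      rreg s0 3 + (if nreg s0 2 != enum_rank e then summand (nreg s0 2) else 0).
    by rewrite big_mkcond big_nat_recr //= -big_mkcond r3.
  rewrite /sum_body /sum_inv; cbn [run run_time]; rewrite E1 E2 t1 t2 /= n1.
  have [lt_i|gt_i|eq_i] := ltngtP (nreg s0 2) (enum_rank e).
  + split; last by []. split=> //=.
    * by rewrite /upd /= addSnnS.
    * by rewrite /upd /= sumS lt_eqF // addrA.
  + split; last by []. split=> //=.
    * by rewrite /upd /= addSnnS.
    * by rewrite /upd /= sumS gt_eqF // addrA.
  + split; last by []. split=> //=.
    * by rewrite /upd /= addSnnS.
    * by rewrite /upd /= sumS eq_i eqxx /= addr0.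
(* The failed test gives one inequality between the counter and the size of the ground set, the
   invariant the other. *)
exists s', t; split=> //; rewrite r3 -sum_summand; congr (\sum_(0 <= _ < _ | _) _).
apply/eqP; rewrite eqn_leq -{1}n2 leq_addr leqNgt -n0; exact: stop.
Qed.

Variable T : nat.
Hypothesis adm_ok : forall x y : R, x <= y ->
  decides_admissible_within O (e : ground (set_interval_of e x y)) T.
Hypothesis wfI : wf_instance I.
Hypothesis finT : finite_threshold e.

Let K := Kbound e.

Lemma Kbound_ge0 : 0 <= K.
Proof. by apply: sumr_ge0 => f _; rewrite addr_ge0. Qed.

Lemma adm_answer_plus (x y : R) : x < - K -> x <= y ->
  (adm_answer O (e : ground (set_interval_of e x y)) : Prop) <->
  (y%:E <= Tplus e)%E.
Proof.
move=> xK xy; have [-> _] := adm_ok xy; exact: (Tplus_ge_admissible finT xK xy).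
Qed.

Lemma adm_answer_minus (x y : R) : K < y -> x <= y ->
  (adm_answer O (e : ground (set_interval_of e x y)) : Prop) <->
  (Tminus e <= x%:E)%E.
Proof.
move=> Ky xy; have [-> _] := adm_ok xy; exact: (Tminus_le_admissible finT Ky xy).
Qed.

(** The index [k] bounds the halvings still required, as the width is at most [delta] at [k = 0].
    Keeping the whole bracket inside [[-K, K]] places the final lower end there too. *)
Definition brackets (c : \bar R) (k : nat) (a w : R) : Prop :=
  [/\ 0 <= w <= delta * 2 ^+ k, - K <= a, a + w <= K &
      (a%:E <= c <= (a + w)%:E)%E].

Lemma brackets_init (c : \bar R) (k : nat) : 2 * K <= delta * 2 ^+ k ->
  ((- K)%:E <= c <= K%:E)%E -> brackets c k (- K) (K + K).
Proof.
have K0 := Kbound_ge0; move=> kK cK; rewrite /brackets addKr.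
by split; rewrite ?addr_ge0 //= (_ : K + K = 2 * K) //; lra.
Qed.

Lemma brackets_final (c : \bar R) (k : nat) (a w : R) :
  brackets c k a w -> w <= delta ->
  - K <= a <= K /\ (a%:E <= c <= (a + delta)%:E)%E.
Proof.
move=> [/andP[w0 _] aK awK /andP[-> cw]] wd; split; first lra.
by apply: le_trans cw _; rewrite lee_fin lerD2l.
Qed.

Lemma brackets_upper (c : \bar R) (k : nat) (a w : R) :
  brackets c k.+1 a w -> ((a + w / 2)%:E <= c)%E ->
  brackets c k (a + w / 2) (w / 2).
Proof.
move=> [/andP[w0 w1] aK awK /andP[_ caw]] ac.
have half : a + w / 2 + w / 2 = a + w by lra.
split; rewrite ?half ?ac //; last by lra.
by rewrite divr_ge0 //= ler_pdivrMr // -mulrA -exprSr.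
Qed.

Lemma brackets_lower (c : \bar R) (k : nat) (a w : R) :
  brackets c k.+1 a w -> (c <= (a + w / 2)%:E)%E -> brackets c k a (w / 2).
Proof.
move=> [/andP[w0 w1] aK awK /andP[ac _]] ca.
split; rewrite ?ac //; last by lra.
by rewrite divr_ge0 //= ler_pdivrMr // -mulrA -exprSr.
Qed.

Definition plus_inv (k : nat) (s : state R) : Prop :=
  [/\ inputs_kept s, rreg s 3 = K, rreg s 8 = - K - 1, rreg s 9 = 2 &
      brackets (Tplus e) k (rreg s 6) (rreg s 7)].

Lemma plus_loop (k : nat) (s : state R) : plus_inv k s -> exists s' t,
  [/\ exec O e (While (RLt 0 7) plus_body) s s' t,
      exists j, plus_inv j s', rreg s' 7 <= delta & (t <= k * (T + 5) + 1)%N].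
Proof.
move=> invs.
(* The body costs [T + 4]: a division, an addition, the oracle call, and a branch of 2 steps. *)
have [|{k invs} k s0|s' [t [ex inv stop tc]]] :=
  @exec_while R O I e (RLt 0 7) plus_body (T + 4) plus_inv isT _ _ _ _ invs.
- move=> s0 [[_ r0 _] _ _ _ [/andP[_ w1] _ _ _]].
  by rewrite /= r0 -leNgt; rewrite expr0 mulr1 in w1.
- move=> [[n5 r0 r10] r3 r8 r9 br] _.
  set y := rreg s0 6 + rreg s0 7 / 2.
  have xy : - K - 1 <= y by rewrite /y; case: br => /andP[w0 _] *; lra.
  have xK : - K - 1 < - K by lra.
  have ansP := adm_answer_plus xK xy; have [_ tadm] := adm_ok xy.
  have leT m : (m <= T -> 1 + (1 + (m + 2)) <= T + 4)%N by lia.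
  rewrite /plus_inv /= /upd /= n5 r10 r8 r9 -/y addr0.
  move: ansP tadm; case: (adm_answer _ _) => ansP tadm; split;
    try exact: leT.
    by split=> //; apply: brackets_upper => //; exact/ansP.
  (* A negative answer refutes [y <= Tplus e], so the infimum lies below the midpoint. *)
  split=> //; apply: brackets_lower => //.
  by apply/ltW; rewrite ltNge; apply/negP => /ansP.
exists s', t; split=> //.
  by have [j [[_ <- _] _ _ _ _]] := inv; rewrite leNgt.
by rewrite -addnS in tc.
Qed.

(** The parameter [a] records that r_6, the result of the first search, survives the second. *)
Definition minus_inv (a : R) (k : nat) (s : state R) : Prop :=
  [/\ inputs_kept s, rreg s 6 = a, rreg s 8 = K + 1, rreg s 9 = 2 &
      brackets (Tminus e) k (rreg s 1) (rreg s 7)].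

Lemma minus_loop (a : R) (k : nat) (s : state R) : minus_inv a k s -> exists s' t,
  [/\ exec O e (While (RLt 0 7) minus_body) s s' t,
      exists j, minus_inv a j s', rreg s' 7 <= delta & (t <= k * (T + 5) + 1)%N].
Proof.
move=> invs.
have [|{k invs} k s0|s' [t [ex inv stop tc]]] :=
  @exec_while R O I e (RLt 0 7) minus_body (T + 4) (minus_inv a) isT _ _ _ _ invs.
- move=> s0 [[_ r0 _] _ _ _ [/andP[_ w1] _ _ _]].
  by rewrite /= r0 -leNgt; rewrite expr0 mulr1 in w1.
- move=> [[n5 r0 r10] r6 r8 r9 br] _.
  set x := rreg s0 1 + rreg s0 7 / 2.
  have xy : x <= K + 1 by rewrite /x; case: br => /andP[w0 _] *; lra.
  have Ky : K < K + 1 by lra.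
  have ansP := adm_answer_minus Ky xy; have [_ tadm] := adm_ok xy.
  have leT m : (m <= T -> 1 + (1 + (m + 2)) <= T + 4)%N by lia.
  rewrite /minus_inv /= /upd /= n5 r10 r8 r9 -/x addr0.
  move: ansP tadm; case: (adm_answer _ _) => ansP tadm; split;
    try exact: leT.
    by split=> //; apply: brackets_lower => //; exact/ansP.
  split=> //; apply: brackets_upper => //.
  by apply/ltW; rewrite ltNge; apply/negP => /ansP.
exists s', t; split=> //.
  by have [j [[_ <- _] _ _ _ _]] := inv; rewrite leNgt.
by rewrite -addnS in tc.
Qed.

Lemma locateP (k : nat) (s : state R) :
  2 * K <= delta * 2 ^+ k -> sum_inv #|ground I| s -> exists s' t,
  [/\ exec O e locate s s' t, nreg s' 0 = 0%N,
      (t <= #|ground I| * 10 + k * (T + 5) * 2 + 14)%N,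
      - K <= rreg s' 0 <= K /\
        ((rreg s' 0)%:E <= Tplus e <= (rreg s' 0 + delta)%:E)%E &
      - K <= rreg s' 1 <= K /\
        ((rreg s' 1)%:E <= Tminus e <= (rreg s' 1 + delta)%:E)%E].
Proof.
move=> kK invs; have [Tp Tm] := Tplus_Tminus_bound wfI finT.
have [s1 [t1 [ex1 [n5 r0 r10] r3 le1]]] := sum_loop invs.
have E2 := exec_run O e s1 (isT : loop_free plus_init).
have inv2 : plus_inv k (run O e plus_init s1).
  rewrite /plus_inv /= /upd /= r3 r10 -/K sub0r.
  by split=> //; exact: brackets_init.
have [s3 [t3 [ex3 [j3 inv3] w3 le3]]] := plus_loop inv2.
have E4 := exec_run O e s3 (isT : loop_free minus_init).
have [[n5' r0' r10'] r3' _ r9' br3] := inv3.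
have inv4 : minus_inv (rreg s3 6) k (run O e minus_init s3).
  rewrite /minus_inv /= /upd /= r3' r10' sub0r.
  by split=> //; exact: brackets_init.
have [s5 [t5 [ex5 [j5 inv5] w5 le5]]] := minus_loop inv4.
have [[_ _ r10''] r6'' _ _ br5] := inv5.
have E6 := exec_run O e s5 (isT : loop_free output_prog).
eexists; eexists; split.
- exact: ExecSeq ex1 (ExecSeq E2 (ExecSeq ex3 (ExecSeq E4 (ExecSeq ex5 E6)))).
- by [].
(* The constant 14 collects 5, 4 and 2 steps of the straight-line pieces and the failing tests of
   three loops. *)
- by rewrite [run_time _ _ plus_init _]/= [run_time _ _ minus_init _]/=
    [run_time _ _ output_prog _]/=; lia.
- by rewrite /= /upd /= r6'' r10'' addr0; exact: brackets_final br3 w3.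
- by rewrite /= /upd /=; exact: brackets_final br5 w5.
Qed.

End Correctness.

(** * Detection of infinite thresholds by two minimisations *)

Section Detection.
Variables (R : realType) (O : oracles R) (I : instance R) (e : ground I).
Variable TOPT : nat.
Hypothesis opt_ok : forall w, solves_min_weight_within O (feasible I) w TOPT.

Definition point_weight (x : R) (f : ground I) : R := if f == e then x else 0.

(** The array is required to vanish only off [e], so the second probe can start from the array left
    by the first. *)
Lemma run_probe (z : int) (i : nat) (s : state R) :
  nreg s 1 = enum_rank e ->
  (forall j : nat, j != enum_rank e -> weights s j = 0) ->
  exists S u,
    [/\ min_weight_solution (feasible I) (point_weight z%:~R) S,
        run O e (probe z i) s =
          State (upd (nreg s) i (e \in S)) (upd (rreg s) 2 z%:~R)
                (upd (weights s) (enum_rank e) z%:~R) u &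
        (run_time O e (probe z i) s <= TOPT + 3)%N].
Proof.
move=> n1 w0; pose s1 := step O e (WStore 1 2) (step O e (RConst 2 z) s).
have sw : @stored_weights R I s1 = point_weight z%:~R.
  apply/funext => f; rewrite /stored_weights /point_weight.
  have -> : weights s1 (enum_rank f) =
      if enum_rank f == enum_rank e then z%:~R else weights s (enum_rank f).
    by rewrite -(inj_eq (@ord_inj _)) -n1.
  rewrite (inj_eq enum_rank_inj); case: ifPn => // fe; apply: w0.
  by rewrite (inj_eq (@ord_inj _)) (inj_eq enum_rank_inj).
have [opt_min opt_t] := opt_ok (@stored_weights R I s1).
set S := opt_answer _ _ _ in opt_min.
exists S, (bits (step O e CallOpt s1)); split.
- by rewrite -sw.
- by rewrite -(nth_map_enum_rank false (fun f => f \in S) e) -n1.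
- have le m : (m <= TOPT -> 1 + (1 + (m + 1)) <= TOPT + 3)%N by lia.
  exact: le opt_t.
Qed.

Lemma weight_point (x : R) (S : {set ground I}) :
  weight (point_weight x) S = if e \in S then x else 0.
Proof.
rewrite (weight_off e) {2}/point_weight eqxx {1}/weight big1 ?add0r // => f _.
by rewrite /off /point_weight; case: (f == e).
Qed.

(** A feasible set avoiding [e] would cost 0 and beat the optimum, which costs 1. *)
Lemma probe_mandatory (S : {set ground I}) :
  min_weight_solution (feasible I) (point_weight 1%:~R) S ->
  e \in S -> forall S', S' \in feasible I -> e \in S'.
Proof.
move=> [_ Smin] eS S' /Smin; rewrite !weight_point eS.
by case: (e \in S') => //; rewrite ler10.
Qed.

(** A feasible set containing [e] would cost -1 and beat the optimum, which costs 0. *)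
Lemma probe_forbidden (S : {set ground I}) :
  min_weight_solution (feasible I) (point_weight (-1)%:~R) S ->
  e \notin S -> forall S', S' \in feasible I -> e \notin S'.
Proof.
move=> [_ Smin] /negbTE eS S' /Smin; rewrite !weight_point eS.
by case: (e \in S') => //; rewrite lerNr oppr0 ler10.
Qed.

Lemma run_detect (delta : R) : exists (S S' : {set ground I}),
  let s := run O e detect (init_state e delta) in
  [/\ min_weight_solution (feasible I) (point_weight 1%:~R) S,
      min_weight_solution (feasible I) (point_weight (-1)%:~R) S',
      nreg s 3 = (e \in S) /\ nreg s 4 = (e \in S'),
      nreg s 5 = 0%N /\ sum_inv e delta #|ground I| s &
      (run_time O e detect (init_state e delta) <= 2 * TOPT + 6)%N].
Proof.
have [||S [u [minS E1 t1]]] := @run_probe 1 3 (init_state e delta) => //.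
have [||S' [u' [minS' E2 t2]]] := @run_probe (-1) 4 (run O e (probe 1 3) (init_state e delta)).
- by rewrite E1.
- by move=> j je; rewrite E1 /= /upd (negbTE je).
exists S, S'; rewrite /detect; cbn [run run_time]; rewrite E2 E1 /=; split=> //.
  split=> //; split=> //.
  by rewrite /upd /= big_geq.
by rewrite E1 in t2 *; move: t1 t2; rewrite /=; lia.
Qed.

End Detection.

(** * Assembly of detection and location *)

Theorem theorem3p8 (R : realType) :
  exists (P : prog) (C : nat),
  forall (class : instance R -> Prop) (O : oracles R)
         (T TOPT : instance R -> nat),
    (forall I, class I -> wf_instance I) ->
    (forall I, class I -> forall e : ground I,
       decides_admissible_within O e (T I) /\
       forall x y : R, x <= y ->
         decides_admissible_within O
           (e : ground (set_interval_of e x y)) (T I)) ->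
    (forall I, class I -> forall w : ground I -> R,
       solves_min_weight_within O (feasible I) w (TOPT I)) ->
  forall I, class I -> forall (e : ground I) (delta : R), 0 < delta ->
  exists (s : state R) (t : nat),
    [/\ exec O e P (init_state e delta) s t,
        t%:R <= C%:R * ((T I)%:R * log_factor (2 * Kbound e / delta)
                        + (TOPT I)%:R) :> R &
        if says_infinite s then
          (Tminus e = +oo%E \/ Tminus e = -oo%E) /\
          (Tplus e = +oo%E \/ Tplus e = -oo%E)
        else
          let a := output_a s in
          let b := output_b s in
          [/\ - Kbound e <= a <= Kbound e,
              - Kbound e <= b <= Kbound e,
              (a%:E <= Tplus e <= (a + delta)%:E)%E &
              (b%:E <= Tminus e <= (b + delta)%:E)%E]].
Proof.
exists threshold_prog, 100%N => class O T TOPT class_wf adm_ok opt_ok I cI e delta d0.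
have wfI := class_wf I cI; have [adm0 admI] := adm_ok I cI e.
have optI := opt_ok I cI.
(* The time model charges at least one step per oracle call and one step per weight for a
   minimisation. Thus [T I] absorbs the overhead of each round, and [TOPT I] the summation of
   [Kbound e]. *)
have T1 : (1 <= T I)%N by have [_] := adm0; exact: leq_trans.
have TO : (#|ground I| <= TOPT I)%N.
  by have [_] := optI (fun=> 0); apply: leq_trans; exact: leq_addr.
have TO1 : (1 <= TOPT I)%N by apply: leq_trans TO; apply/card_gt0P; exists e.
(* Nonnegativity follows from [0 <= k <= 2 * log_factor]. *)
have L0 : 0 <= log_factor (2 * Kbound e / delta).
  by have [k [_]] := halvings (2 * Kbound e) d0; have := ler0n R k; lra.
have short t : (t <= 100 * TOPT I)%N -> t%:R <= 100%:R * ((T I)%:R *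
    log_factor (2 * Kbound e / delta) + (TOPT I)%:R) :> R.
  move=> le_t; apply: (@le_trans _ _ (100 * TOPT I)%:R); first by rewrite ler_nat.
  by rewrite natrM ler_wpM2l // lerDr mulr_ge0.
have [S [S' [minS minS' [n3 n4] [n5 inv] td]]] := run_detect e optI delta.
have Ed := exec_run O e (init_state e delta) (isT : loop_free detect).
set s0 := run _ _ _ _ in n3 n4 n5 inv Ed.
have b3 : eval_test (NLt 5 3) s0 = (e \in S).
  by rewrite /eval_test n5 n3 lt0b.
have b4 : eval_test (NLt 5 4) s0 = (e \in S').
  by rewrite /eval_test n5 n4 lt0b.
have [eS|eS] := boolP (e \in S).
  have [-> ->] := infinite_of_mandatory wfI (probe_mandatory minS eS).
  exists (step O e (NConst 0 1) s0); eexists; split; last by split; left.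
    apply: ExecSeq Ed _; apply: ExecIf; rewrite b3 eS; exact: ExecDo.
  apply: short; apply: leq_trans (leq_add td (leqnn _)) _ => /=; lia.
have [eS'|eS'] := boolP (e \in S'); last first.
  have [-> ->] := infinite_of_forbidden wfI (probe_forbidden minS' eS').
  exists (step O e (NConst 0 1) s0); eexists; split; last by split; right.
    apply: ExecSeq Ed _; apply: ExecIf; rewrite b3 (negbTE eS).
    apply: ExecIf; rewrite b4 (negbTE eS'); exact: ExecDo.
  apply: short; apply: leq_trans (leq_add td (leqnn _)) _ => /=; lia.
have finT : finite_threshold e.
  by split; [exists S; rewrite // minS.1 | exists S'; rewrite // minS'.1].
have [k [kK kL]] := halvings (2 * Kbound e) d0.
have [s [t [ex n0 le_t [aK aT] [bK bT]]]] := locateP admI wfI finT kK inv.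
exists s; eexists; split.
- apply: ExecSeq Ed _; apply: ExecIf; rewrite b3 (negbTE eS).
  by apply: ExecIf; rewrite b4 eS'; exact: ex.
- apply: (@le_trans _ _ (100 * TOPT I + 12 * (T I * k))%:R).
    by rewrite ler_nat; exact: time_budget TO TO1 T1 td le_t.
  rewrite natrD !natrM mulrDr addrC lerD2r //.
  (* Replacing [k] by [2 * log_factor] turns 12 into 24, well within the constant 100. *)
  apply: (@le_trans _ _ (12 * ((T I)%:R * (2 * log_factor (2 * Kbound e / delta))))).
    by rewrite ler_wpM2l // ler_wpM2l.
  have : 0 <= (T I)%:R * log_factor (2 * Kbound e / delta) :> R by rewrite mulr_ge0.
  lra.
- by rewrite /says_infinite n0.
Qed.
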